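(* Let $\mathcal{S}\subseteq\Sigma^{<\omega}$ be the set of all stratified well-formed formulae of set theory, regarded as strings over the alphabet $\Sigma=\{[,\ ],\ \to,\ \forall,\ \doteq,\ \in,\ w,\ \circledast,\ \bot\}$. Then $\mathcal{S}$ is not a context-free language.
   Context: A formal language over a finite alphabet $\Sigma$ is a subset of $\Sigma^{<\omega}$, the set of finite strings over $\Sigma$. A language is context-free if it is the set of all terminal strings generated from the start symbol of some context-free grammar (finite sets of nonterminals and production rules, each rule replacing a single nonterminal by a finite string of terminals and nonterminals). Syntax of set theory: the alphabet consists of the nine symbols $[$, $]$, $\to$, $\forall$, $\doteq$ (equality symbol), $\in$, $w$, $\circledast$, $\bot$. Well-formed formulae are strings defined as follows. (1) Variables: $w$ is a variable; if $\alpha$ is a variable then the string $\alpha\circledast$ is a variable (so the variables are exactly the strings $w\circledast^n$, $n\in\mathbb{N}$). (2) Atomic formulae: $\bot$ is an atomic formula; if $\alpha,\beta$ are variables then $\alpha\doteq\beta$ and $\alpha\in\beta$ are atomic formulae. (3) Formulae: every atomic formula is a formula; if $\varphi,\psi$ are formulae and $\alpha$ is a variable then $[\forall\alpha]\varphi$ and $[\varphi\to\psi]$ are formulae. Stratification: let $\varphi$ be a well-formed formula and $X$ the set of variables appearing in $\varphi$. A stratification of $\varphi$ is a function $\sigma\colon X\to\mathbb{Z}$ such that whenever $x\in y$ appears as a subformula of $\varphi$, $\sigma(x)=\sigma(y)-1$, and whenever $x\doteq y$ appears as a subformula of $\varphi$, $\sigma(x)=\sigma(y)$. A formula is stratified if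 it has a stratification. *)

(* Defs.v *)
From HB Require Import structures.
From Stdlib Require Export Relation_Operators.
From mathcomp Require Export all_boot all_algebra.

Set Implicit Arguments.
Unset Strict Implicit.
Unset Printing Implicit Defensive.

Definition language (Sigma : finType) := seq Sigma -> Prop.

Record grammar (Sigma : finType) := Grammar {
  nonterminal : finType;
  start : nonterminal;
  rules : seq (nonterminal * seq (nonterminal + Sigma))
}.

Section ContextFree.
Variable Sigma : finType.

Definition sentential (G : grammar Sigma) := seq (nonterminal G + Sigma).

Inductive step (G : grammar Sigma) : sentential G -> sentential G -> Prop :=
  Step (u v : sentential G) (A : nonterminal G) (r : sentential G) :
    (A, r) \in rules G -> step (u ++ inl A :: v) (u ++ r ++ v).

Definition derives (G : grammar Sigma) :=
  clos_refl_trans (sentential G) (@step G).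

Definition generated (G : grammar Sigma) : language Sigma :=
  fun s => derives [:: inl (start G)] (map inr s).

Definition context_free (L : language Sigma) : Prop :=
  exists G : grammar Sigma, forall s, L s <-> generated G s.

End ContextFree.

Inductive symbol :=
  | LBr | RBr | Arrow | Forall | Doteq | In | W | Star | Bot.

Definition symbol_enum :=
  [:: LBr; RBr; Arrow; Forall; Doteq; In; W; Star; Bot].

Definition symbol_code (a : symbol) : nat :=
  match a with
  | LBr => 0 | RBr => 1 | Arrow => 2 | Forall => 3 | Doteq => 4
  | In => 5 | W => 6 | Star => 7 | Bot => 8
  end.

Lemma symbol_codeK : cancel symbol_code (nth LBr symbol_enum).
Proof. by case. Qed.

HB.instance Definition _ := Countable.copy symbol (can_type symbol_codeK).

Lemma symbol_enumP : Finite.axiom symbol_enum.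
Proof. by case. Qed.

HB.instance Definition _ := isFinite.Build symbol symbol_enumP.

Notation str := (seq symbol).

Definition eq_str (x y : str) : str := x ++ Doteq :: y.
Definition mem_str (x y : str) : str := x ++ In :: y.
Definition forall_str (x p : str) : str := [:: LBr; Forall] ++ x ++ RBr :: p.
Definition imp_str (p q : str) : str := LBr :: p ++ Arrow :: q ++ [:: RBr].

Inductive variable : str -> Prop :=
  | var_w : variable [:: W]
  | var_star x : variable x -> variable (rcons x Star).

Inductive atomic : str -> Prop :=
  | atomic_bot : atomic [:: Bot]
  | atomic_eq x y : variable x -> variable y -> atomic (eq_str x y)
  | atomic_mem x y : variable x -> variable y -> atomic (mem_str x y).

Inductive formula : str -> Prop :=
  | formula_atomic p : atomic p -> formula p
  | formula_forall x p : variable x -> formula p -> formula (forall_str x p)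
  | formula_imp p q : formula p -> formula q -> formula (imp_str p q).

(* [subformula q p]: q is a subformula of p.  This follows the formation rules
   and is not the substring relation: w\in w is a substring, but not a
   subformula, of w\in w\circledast. *)
Inductive subformula : str -> str -> Prop :=
  | sub_refl p : formula p -> subformula p p
  | sub_forall x p q :
      variable x -> subformula q p -> subformula q (forall_str x p)
  | sub_imp_l p p' q :
      formula p' -> subformula q p -> subformula q (imp_str p p')
  | sub_imp_r p p' q :
      formula p -> subformula q p' -> subformula q (imp_str p p').

(* [appears x p]: the variable x appears in the formula p.  As for subformulae,
   w does not appear in w\circledast\in w\circledast; the variable bound by a
   quantifier does appear. *)
Inductive appears (x p : str) : Prop :=
  | appears_eq y : variable x -> variable y ->
      subformula (eq_str x y) p \/ subformula (eq_str y x) p -> appears x p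
  | appears_mem y : variable x -> variable y ->
      subformula (mem_str x y) p \/ subformula (mem_str y x) p -> appears x p
  | appears_forall q : variable x ->
      subformula (forall_str x q) p -> appears x p.

(* The value of sigma could a priori depend on the proof of appearance; the
   conditions are required for all such proofs, so existence of a
   stratification is unaffected. *)
Definition stratification (p : str) (sigma : {x : str | appears x p} -> int)
    : Prop :=
  (forall x y : {x : str | appears x p},
     subformula (mem_str (sval x) (sval y)) p ->
     sigma x = (sigma y - 1)%R) /\
  (forall x y : {x : str | appears x p},
     subformula (eq_str (sval x) (sval y)) p -> sigma x = sigma y).

Definition stratified (p : str) : Prop :=
  exists sigma : {x : str | appears x p} -> int, stratification sigma.

Definition stratified_formulae : language symbol :=
  fun s => formula s /\ stratified s.

(* Main.v *)
Require Import Defs.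
From Stdlib Require Import Operators_Properties.
From mathcomp Require Import zify.

Set Implicit Arguments.
Unset Strict Implicit.
Unset Printing Implicit Defensive.

(** Only the shrinking half of the pumping lemma is needed: a long word of a
    context-free language has a short window [v ++ x ++ y] from which [v] and
    [y], not both empty, can be deleted.  It is applied to an implication chain
    [A_1 -> [A_2 -> ... -> bot]] of atoms "x_p in x_q" (x_n being w followed by n
    stars) in which every constraint of a list [links h] is repeated three times.
    The atoms are longer than the window, so the window misses one kind of
    bracket; counting symbols in formulae then shows that only stars are deleted.
    This alters at most two atoms, so every constraint survives somewhere and the
    level of each x_e, e < 2h, is still determined up to a shift.  The
    constraints follow the zigzag 0, 2h-1, 1, 2h-2, 2, ..., whose consecutive
    entries have sum 2h-1 or 2h, and this forbids shortening the variables of any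
    atom. *)

(** * Derivation forests and their equivalence with derivations *)

Section Pumping.

Variables (Sigma : finType) (G : grammar Sigma).
Notation nt := (nonterminal G).

(* [der n h alpha w]: a forest with [n] inner nodes and height [h], with roots
   [alpha] and yield [w]. *)
Inductive der : nat -> nat -> sentential G -> seq Sigma -> Prop :=
  | der_nil : der 0 0 [::] [::]
  | der_term n h a alpha w :
      der n h alpha w -> der n h (inr a :: alpha) (a :: w)
  | der_nt n1 h1 n2 h2 A r alpha w1 w2 : (A, r) \in rules G ->
      der n1 h1 r w1 -> der n2 h2 alpha w2 ->
      der (n1 + n2).+1 (maxn h1.+1 h2) (inl A :: alpha) (w1 ++ w2).

(** The height serves only to bound yields and to find repeated labels; the size, kept here, is the
    induction measure of [sder_shrink]. *)
Definition sder n alpha w := exists h, der n h alpha w.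

Lemma der_split alpha beta n h w : der n h (alpha ++ beta) w ->
  exists n1 n2 w1 w2, [/\ n = n1 + n2, w = w1 ++ w2,
    sder n1 alpha w1 & sder n2 beta w2].
Proof.
elim: alpha n h w => [|[A|a] alpha IH] n h w /=.
- by move=> d; exists 0, n, [::], w; split=> //; [exists 0; constructor|exists h].
- move=> d; inversion d as [| |m1 k1 m2 k2 B r gam v1 v2 rin d1 d2]; subst.
  have [p1 [p2 [x1 [x2 [-> -> [h1 s1] s2]]]]] := IH _ _ _ d2.
  exists (m1 + p1).+1, p2, (v1 ++ x1), x2; split=> //; first lia.
    by rewrite catA.
  by exists (maxn k1.+1 h1); apply: der_nt rin d1 s1.
- move=> d; inversion d as [|m k b gam v d1|]; subst.
  have [p1 [p2 [x1 [x2 [-> -> [h1 s1] s2]]]]] := IH _ _ _ d1.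
  by exists p1, p2, (a :: x1), x2; split=> //; exists h1; apply: der_term.
Qed.

Lemma sder_cat alpha beta n1 n2 w1 w2 : sder n1 alpha w1 -> sder n2 beta w2 ->
  sder (n1 + n2) (alpha ++ beta) (w1 ++ w2).
Proof.
move=> [h d] s2.
elim: d => {n1 h alpha w1} [//|n h a alpha w _ [k IH]|].
  by exists k; apply: der_term.
move=> m1 h1 m2 h2 A r alpha v1 v2 rin d1 _ _ [k IH].
exists (maxn h1.+1 k); rewrite -catA addSn -addnA.
exact: der_nt rin d1 IH.
Qed.

Lemma sder_rule A r n w : (A, r) \in rules G -> sder n r w ->
  sder n.+1 [:: inl A] w.
Proof.
move=> rin [h d]; exists (maxn h.+1 0).
by rewrite -[w]cats0 -[n]addn0; apply: der_nt rin d der_nil.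
Qed.

Lemma derives_cat (u v alpha beta : sentential G) :
  derives alpha beta -> derives (u ++ alpha ++ v) (u ++ beta ++ v).
Proof.
elim=> {alpha beta} [_ _ [u' v' A r rin]|alpha|x y z _ IH1 _ IH2].
- apply: rt_step.
  have := Step (u ++ u') (v' ++ v) rin.
  by rewrite -!catA.
- exact: rt_refl.
- exact: rt_trans IH1 IH2.
Qed.

Lemma der_derives n h alpha w : der n h alpha w -> derives alpha (map inr w).
Proof.
elim=> {n h alpha w} [|n h a alpha w _ IH|].
- exact: rt_refl.
- by have := derives_cat [:: inr a] [::] IH; rewrite !cats0.
- move=> n1 h1 n2 h2 A r alpha w1 w2 rin _ IH1 _ IH2.
  apply: (rt_trans _ _ _ (r ++ alpha)); first exact/rt_step/(Step [::] alpha rin).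
  rewrite map_cat; apply: (rt_trans _ _ _ (map inr w1 ++ alpha)).
    exact: (derives_cat [::] alpha IH1).
  by have := derives_cat (map inr w1) [::] IH2; rewrite !cats0.
Qed.

Lemma sder_map_inr w : sder 0 (map inr w) w.
Proof.
elim: w => [|a w [h IH]]; first by exists 0; constructor.
by exists h; apply: der_term.
Qed.

Lemma derives_sder alpha w : derives alpha (map inr w) ->
  exists n, sder n alpha w.
Proof.
move=> /clos_rt_rt1n_iff.
move E: (map inr w) => beta d; elim: d E => {alpha beta} [|alpha beta gam].
  by move=> _ <-; exists 0; apply: sder_map_inr.
move=> [u v A r rin] _ IH /IH [n [h d]].
have [n1 [n2 [w1 [w2 [_ -> s1 [h2 d2]]]]]] := der_split d.
have [n3 [n4 [w3 [w4 [_ -> s3 s4]]]]] := der_split d2.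
exists (n1 + (n3.+1 + n4)); apply: sder_cat s1 _.
by rewrite -cat1s; apply: sder_cat s4; apply: sder_rule rin s3.
Qed.

Lemma generated_sder w : generated G w <-> exists n, sder n [:: inl (start G)] w.
Proof.
split; first exact: derives_sder.
by move=> [n [h /der_derives]].
Qed.

(** * Heights, contexts and the shrinking lemma *)

Definition rule_width := (\max_(r <- rules G) size r.2).+1.

Lemma der_size n h alpha w : der n h alpha w ->
  size w <= size alpha * rule_width ^ h.
Proof.
elim=> {n h alpha w} [|n h a alpha w _ IH|].
- by [].
- by rewrite /= mulSn -add1n leq_add // expn_gt0.
- move=> n1 h1 n2 h2 A r alpha w1 w2 rin _ IH1 _ IH2.
  rewrite size_cat /= mulSn leq_add //.
    apply: leq_trans IH1 _.
    apply: (@leq_trans (rule_width ^ h1.+1)); last by rewrite leq_pexp2l ?leq_maxl.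
    rewrite expnS leq_mul2r; apply/orP; right.
    exact/leqW/(@leq_bigmax_seq _ _ predT (fun r => size r.2) (A, r)).
  by apply: leq_trans IH2 _; rewrite leq_mul2l leq_pexp2l ?leq_maxr ?orbT.
Qed.

(* Contexts: a derivation from [alpha] of size [m], with yield [u ++ _ ++ y],
   missing only the subtree at one node labelled [B]. *)
Definition context m alpha B u y := forall n z,
  sder n [:: inl B] z -> sder (m + n) alpha (u ++ z ++ y).

Lemma context_comp m1 m2 alpha B B' u1 u2 y1 y2 :
  context m1 alpha B u1 y1 -> context m2 [:: inl B] B' u2 y2 ->
  context (m1 + m2) alpha B' (u1 ++ u2) (y2 ++ y1).
Proof.
move=> c1 c2 n z /c2 /c1.
by rewrite -!catA addnA.
Qed.

(** Passing from a tree to the forest of its children lowers the height by exactly one, so no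
    positive value up to [h] is skipped. *)
Lemma subtree n h alpha w h' : der n h alpha w -> 0 < h' <= h ->
  exists B m n' u z y, [/\ n = m + n', w = u ++ z ++ y,
    context m alpha B u y & der n' h' [:: inl B] z].
Proof.
elim=> {n h alpha w} [|n h a alpha w _ IH|]; first by lia.
  move=> /IH [B [m [n' [u [z [y [-> -> c d]]]]]]].
  exists B, m, n', (a :: u), z, y; split=> // p x /c [k e].
  by exists k; apply: der_term.
move=> n1 h1 n2 h2 A r alpha w1 w2 rin d1 IH1 d2 IH2 /andP[h'0 h'h].
have [le2|lt2] := leqP h' h2.
  have [|B [m [n' [u [z [y [-> -> c d]]]]]]] := IH2; first by rewrite h'0.
  exists B, (n1 + m).+1, n', (w1 ++ u), z, y; split=> //; first by lia.
    by rewrite catA.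
  move=> p x /c s; rewrite addSn -addnA -catA -addSn -cat1s.
  by apply: sder_cat s; apply: sder_rule rin _; exists h1.
have [le1|lt1] := leqP h' h1.
  have [|B [m [n' [u [z [y [-> -> c d]]]]]]] := IH1; first by rewrite h'0.
  exists B, (m + n2).+1, n', u, z, (y ++ w2); split=> //; first by lia.
    by rewrite -!catA.
  move=> p x /c s.
  have -> : (m + n2).+1 + p = (m + p).+1 + n2 by lia.
  rewrite !catA -(catA u) -cat1s; apply: sder_cat (sder_rule rin s) _.
  by exists h2.
have -> : h' = h1.+1 by lia.
exists A, n2, (n1 + 0).+1, [::], w1, w2; split=> //; first by lia.
  move=> p x s; rewrite addnC -cat1s.
  by apply: sder_cat s _; exists h2.
rewrite -[w1]cats0 -[h1.+1]maxn0; exact: der_nt rin d1 der_nil.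
Qed.

(** The strict bound [h' < h] puts the node below the root; the context then has positive size, so
    cutting it out makes the derivation strictly smaller. *)
Lemma proper_subtree n h A w h' : der n h [:: inl A] w -> 0 < h' < h ->
  exists B m n' u z y, [/\ n = m.+1 + n', w = u ++ z ++ y,
    context m.+1 [:: inl A] B u y & der n' h' [:: inl B] z].
Proof.
move=> d hh.
inversion d as [| |m1 k1 m2 k2 B r gam v1 v2 rin d1 d2]; subst.
inversion d2; subst.
have [|B [m [n' [u [z [y [-> -> c d']]]]]]] := subtree (h' := h') d1; first by lia.
exists B, m, n', u, z, y; split=> //; first by lia.
  by rewrite cats0.
by move=> p x /c s; rewrite addSn; apply: sder_rule rin s.
Qed.

(* [V] collects the labels already met on the path from the root. *)
Lemma repeated_node h : forall n A w (V : {set nt}), der n h [:: inl A] w ->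
  #|nt| < h + #|V| ->
  (exists B m n' u z y, [/\ B \in V, n = m + n', w = u ++ z ++ y,
     context m [:: inl A] B u y & sder n' [:: inl B] z]) \/
  (exists B m1 u1 y1 m2 u2 y2 n' z,
     [/\ n = m1 + m2.+1 + n', w = u1 ++ (u2 ++ z ++ y2) ++ y1,
         context m1 [:: inl A] B u1 y1, context m2.+1 [:: inl B] B u2 y2
       & sder n' [:: inl B] z]).
Proof.
elim: h => [|h IH] n A w V d.
  by move=> lt; have := max_card V; lia.
have id_ctx : context 0 [:: inl A] A [::] [::].
  by move=> p x; rewrite cats0.
have [AV|AV] := boolP (A \in V).
  move=> _; left; exists A, 0, n, [::], w, [::]; split=> //; first by rewrite cats0.
  by exists h.+1.
case: h IH d => [|h] IH d lt.
  have : #|V| < #|nt|.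
    by rewrite -cardsT; apply: proper_card; rewrite properE subsetT; apply/subsetPn; exists A.
  by lia.
(* The height drops by exactly one while [A] joins [V], so the counting hypothesis is preserved. *)
have [|B [m [n' [u [z [y [-> -> c d']]]]]]] := proper_subtree (h' := h.+1) d; first by lia.
have [||] := IH _ _ _ (A |: V) d'; first by rewrite cardsU1 AV; lia.
  move=> [B' [m' [n2 [u' [z' [y' [B'V -> -> c' s]]]]]]].
  have cc := context_comp c c'.
  (* If the label met again is [A], the root and that node are the repeated pair; otherwise its
     earlier occurrence lies above the root. *)
  move: B'V; rewrite in_setU1 => /orP[/eqP EB|B'V].
    subst B'; right; exists A, 0, [::], [::], (m + m'), (u ++ u'), (y' ++ y), n2, z'.
    by split=> //; rewrite ?cats0 -?catA //; lia.
  left; exists B', (m.+1 + m'), n2, (u ++ u'), z', (y' ++ y).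
  by split=> //; rewrite -?catA //; lia.
move=> [B' [m1 [u1 [y1 [m2 [u2 [y2 [n2 [z' [-> -> c1 c2 s]]]]]]]]]].
right; exists B', (m.+1 + m1), (u ++ u1), (y1 ++ y), m2, u2, y2, n2, z'.
by split=> //; rewrite -?catA //; [lia|exact: context_comp c c1].
Qed.

(** A subtree of height exactly [#|nt|.+1] is low enough to have a short yield and high enough to
    repeat a label along a path. Splicing out the part between the two occurrences shrinks the
    derivation. *)
Lemma sder_shrink n A w : sder n [:: inl A] w ->
  rule_width ^ #|nt|.+1 < size w ->
  exists u v x y z n', [/\ w = u ++ (v ++ x ++ y) ++ z,
    size (v ++ x ++ y) <= rule_width ^ #|nt|.+1, v ++ y <> [::]
    & sder n' [:: inl A] (u ++ x ++ z)].
Proof.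
elim/ltn_ind: n w => n IH w [h d] lt.
have hgt : #|nt|.+1 < h.
  rewrite ltnNge; apply/negP => le.
  have := der_size d; rewrite mul1n => sz.
  have := leq_pexp2l (isT : 0 < rule_width) le; lia.
have [|B [m [n1 [u [z [y [En Ew c d1]]]]]]] := subtree (h' := #|nt|.+1) d; first by lia.
have [||] := repeated_node (V := set0) d1; first by rewrite cards0; lia.
  by move=> [B' [? [? [? [? [? []]]]]]]; rewrite inE.
move=> [B' [m1 [u1 [y1 [m2 [u2 [y2 [n2 [x [En1 Ez c1 c2 s]]]]]]]]]].
have s' := context_comp c c1 s.
(* If the removed part yields nothing, the word is unchanged but its derivation has fewer nodes, and
   induction applies. *)
have [E|/eqP NE] := eqVneq (u2 ++ y2) [::].
  have [E1 E2] : u2 = [::] /\ y2 = [::] by case: (u2) E => //= ->.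
  apply: (IH (m + m1 + n2)); [by lia| |by []].
  by move: s'; rewrite Ew Ez E1 E2 /= cats0 -!catA.
exists (u ++ u1), u2, x, y2, (y1 ++ y), (m + m1 + n2); split=> //.
  by rewrite Ew Ez -!catA.
have := der_size d1; rewrite mul1n; apply: leq_trans.
by rewrite Ez !size_cat; lia.
Qed.

End Pumping.

Lemma context_free_shrink (Sigma : finType) (L : language Sigma) :
  context_free L -> exists N, forall s, L s -> N < size s ->
  exists u v x y z, [/\ s = u ++ (v ++ x ++ y) ++ z,
    size (v ++ x ++ y) <= N, v ++ y <> [::] & L (u ++ x ++ z)].
Proof.
move=> [G LG]; exists (rule_width G ^ #|nonterminal G|.+1) => s.
move=> /LG /generated_sder [n d] lt.
have [u [v [x [y [z [n' [Es sz ne d']]]]]]] := sder_shrink d lt.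
exists u, v, x, y, z; split=> //.
by apply/LG/generated_sder; exists n'.
Qed.

(** * Variables and symbol counts of formulae *)

Definition var n : str := W :: nseq n Star.

Lemma rcons_var n : rcons (var n) Star = var n.+1.
Proof. by rewrite /var rcons_cons -cats1 -(nseqD n 1) addn1. Qed.

Lemma variable_var n : variable (var n).
Proof.
elim: n => [|n IH]; first exact: var_w.
by rewrite -rcons_var; apply: var_star.
Qed.

Lemma variableE x : variable x -> x = var (size x).-1.
Proof.
elim=> {x} [//|x _ ->].
by rewrite rcons_var /= size_nseq.
Qed.

Lemma size_var n : size (var n) = n.+1.
Proof. by rewrite /= size_nseq. Qed.

(** Each left bracket opens one implication or one quantifier; atoms are the leaves of a tree
    branching at the arrows; a binary atom holds two variables and a quantifier one, each with a
    single [W]. *)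
Lemma formula_counts s : formula s ->
  [/\ count_mem LBr s = count_mem RBr s,
      count_mem Arrow s + count_mem Forall s = count_mem LBr s,
      count_mem Doteq s + count_mem In s + count_mem Bot s =
        (count_mem Arrow s).+1
    & count_mem W s =
        2 * (count_mem Doteq s + count_mem In s) + count_mem Forall s].
Proof.
elim=> {s} [_ [|x y /variableE-> /variableE->|x y /variableE-> /variableE->]
           |x p /variableE-> _ [e1 e2 e3 e4]|p q _ [e1 e2 e3 e4] _ [f1 f2 f3 f4]].
- by [].
- by rewrite /eq_str /= !count_cat /= !count_nseq.
- by rewrite /mem_str /= !count_cat /= !count_nseq.
- have E a : count_mem a (forall_str (var (size x).-1) p) =
      count_mem a [:: LBr; Forall; RBr] + count_mem a (var (size x).-1) + count_mem a p.
    by rewrite /forall_str !count_cat /=; lia.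
  rewrite !E; move: e1 e2 e3 e4.
  do 8! [move: (count_mem _ p) => ?]; rewrite /= !count_nseq /=; split; lia.
- have E a : count_mem a (imp_str p q) =
      count_mem a [:: LBr; Arrow; RBr] + count_mem a p + count_mem a q.
    by rewrite /imp_str -cat1s !count_cat /= count_cat /=; lia.
  rewrite !E; move: e1 e2 e3 e4 f1 f2 f3 f4.
  do 8! [move: (count_mem _ p) => ?]; do 8! [move: (count_mem _ q) => ?].
  rewrite /=; split; lia.
Qed.

(** * Implication chains, their subformulae and stratifications *)

Definition atom (c : nat * nat) : str := mem_str (var c.1) (var c.2).

Definition chain (L : seq (nat * nat)) : str :=
  foldr (fun c s => imp_str (atom c) s) [:: Bot] L.

Lemma size_atom c : size (atom c) = (c.1 + c.2).+3.
Proof. by rewrite /atom /mem_str size_cat /= !size_nseq; lia. Qed.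

Lemma formula_atom c : formula (atom c).
Proof. exact/formula_atomic/atomic_mem/variable_var/variable_var. Qed.

Lemma formula_chain L : formula (chain L).
Proof.
elim: L => [|c L IH] /=; first exact/formula_atomic/atomic_bot.
exact: formula_imp (formula_atom c) IH.
Qed.

Lemma split_first (T : eqType) (a : T) s1 s2 t1 t2 : a \notin s1 -> a \notin t1 ->
  s1 ++ a :: s2 = t1 ++ a :: t2 -> s1 = t1 /\ s2 = t2.
Proof.
elim: s1 t1 => [|b s1 IH] [|c t1] //=.
- by move=> _ _ [].
- by rewrite inE negb_or => _ /andP[/eqP ne _] [/ne].
- by rewrite inE negb_or => /andP[/eqP ne _] _ [/esym /ne].
- by rewrite !inE !negb_or => /andP[_ n1] /andP[_ n2] [-> /IH []] // -> ->.
Qed.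

Lemma mem_var a n : a \in var n -> (a == W) || (a == Star).
Proof. by rewrite inE mem_nseq => /orP[->//|/andP[_ ->]]; rewrite orbT. Qed.

Lemma mem_atom a c : a \in atom c -> [|| a == W, a == Star | a == In].
Proof.
rewrite mem_cat inE => /or3P[/mem_var /orP[]->|->|/mem_var/orP[]->] //=; by rewrite ?orbT.
Qed.

Lemma formula_W s : formula (W :: s) -> atomic (W :: s).
Proof. by move=> f; inversion f. Qed.

Lemma atomic_no_Arrow s : atomic s -> Arrow \notin s.
Proof.
case=> // x y /variableE-> /variableE->.
  by apply/negP; rewrite mem_cat inE => /or3P[/mem_var||/mem_var].
by apply/negP => /(@mem_atom _ (_, _)).
Qed.

(** A formula starting with [W] is atomic, hence free of arrows, so on both sides the first [Arrow]
    ends the premise. *)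
Lemma imp_atom_inj p q c s : formula p -> imp_str p q = imp_str (atom c) s ->
  p = atom c /\ q = s.
Proof.
move=> fp [E].
have hd : head Arrow p = W by move: E; case: (p) => [|a t] //= [].
have ap : atomic p by case: (p) hd fp => [|a t] //= -> /formula_W.
have [|-> ] := @split_first _ _ _ _ (atom c) _ (atomic_no_Arrow ap) _ E.
  by apply/negP => /mem_atom.
by rewrite !cats1 => /rcons_inj[->].
Qed.

Lemma subformula_formula q p : subformula q p -> formula p.
Proof.
elim=> {q p} [//|x p q vx _|p p' q f _ g|p p' q f _ g]; first exact: formula_forall.
- exact: formula_imp.
- exact: formula_imp.
Qed.

Lemma subformula_atom q c : subformula q (atom c) -> q = atom c.
Proof. by move=> sq; inversion sq. Qed.

Lemma subformula_chain q L : subformula (W :: q) (chain L) ->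
  exists2 c, c \in L & W :: q = atom c.
Proof.
elim: L => [|c L IH] /=; first by move=> sq; inversion sq.
move E: (imp_str _ _) => s; move E': (W :: q) => q' sq.
case: sq E E' => {s q'} [p _ <- //|x p q' _ _ //|p p' q' _ sq|p p' q' fp sq] E E'.
- have [E1 _] := imp_atom_inj (subformula_formula sq) (esym E).
  exists c; first exact: mem_head.
  by apply: subformula_atom; rewrite -E1.
- have [_ E1] := imp_atom_inj fp (esym E).
  rewrite -E' E1 in sq *.
  by have [c' cL ->] := IH sq; exists c' => //; rewrite inE cL orbT.
Qed.

Lemma subformula_chain_mem x y L : variable x -> variable y ->
  subformula (mem_str x y) (chain L) -> ((size x).-1, (size y).-1) \in L.
Proof.
move=> /variableE-> /variableE-> /subformula_chain [[p q] cL].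
rewrite -cat_cons => E.
have [||/(congr1 size) E1 /(congr1 size) E2] := split_first _ _ E.
- by apply/negP => /mem_var.
- by apply/negP => /mem_var.
- move: E1 E2; rewrite !size_var => -> ->.
  by [].
Qed.

Lemma subformula_chain_eq x y L : variable x -> variable y ->
  ~ subformula (eq_str x y) (chain L).
Proof.
move=> /variableE-> /variableE-> /subformula_chain [[p q] cL E].
have : In \in W :: (nseq (size x).-1 Star ++ Doteq :: var (size y).-1).
  by rewrite E mem_cat mem_head orbT.
by rewrite -cat_cons mem_cat inE => /or3P[/mem_var||/mem_var].
Qed.

Lemma mem_subformula_chain c L : c \in L -> subformula (atom c) (chain L).
Proof.
elim: L => //= c' L IH; rewrite inE => /orP[/eqP<-|/IH].
  exact/sub_imp_l/sub_refl/formula_atom/formula_chain.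
exact/sub_imp_r/formula_atom.
Qed.

Lemma appears_variable x p : appears x p -> variable x.
Proof. by case. Qed.

Lemma stratified_chain L (lev : nat -> nat) :
  (forall c, c \in L -> lev c.2 = (lev c.1).+1) -> stratified (chain L).
Proof.
move=> levL; exists (fun x => Posz (lev (size (sval x)).-1)); split.
  move=> [x ax] [y ay] /= /(subformula_chain_mem (appears_variable ax) (appears_variable ay)).
  by move=> /levL /= ->; lia.
move=> [x ax] [y ay] /= s; exfalso.
exact: subformula_chain_eq (appears_variable ax) (appears_variable ay) s.
Qed.

Lemma chain_stratified L : stratified (chain L) ->
  exists tau : nat -> int, forall c, c \in L -> (tau c.2 = tau c.1 + 1)%R.
Proof.
move=> [sigma [smem _]].
pose occ e := has (fun c => (c.1 == e) || (c.2 == e)) L.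
have occ_appears e : occ e -> appears (var e) (chain L).
  move=> /hasP[[p q] /mem_subformula_chain s /= /orP[]/eqP <-].
    by apply: (appears_mem (variable_var p) (variable_var q)); left.
  by apply: (appears_mem (variable_var q) (variable_var p)); right.
(* [sigma] depends on a proof of appearance: one is fixed for each occurring index, and other
   indices get the default 0. *)
pose tau e := if insub e : option {e | occ e} is Some u
  then sigma (exist _ _ (occ_appears (val u) (valP u))) else 0%R.
exists tau => -[p q] cL /=; rewrite /tau.
have op : occ p by apply/hasP; exists (p, q); rewrite //= eqxx.
have oq : occ q by apply/hasP; exists (p, q); rewrite //= eqxx orbT.
rewrite !insubT /=.
set aq := occ_appears q _; set ap := occ_appears p _.
rewrite (smem (exist _ _ ap) (exist _ _ aq)) ?GRing.subrK //.
exact: (mem_subformula_chain cL).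
Qed.

(** * Deleting a run of stars from a chain *)

Definition deletion d (s s' : str) :=
  exists u y, s = u ++ nseq d Star ++ y /\ s' = u ++ y.

Lemma deletion_cons d a s s' : 0 < d -> a != Star -> deletion d (a :: s) s' ->
  exists2 s1, s' = a :: s1 & deletion d s s1.
Proof.
case: d => // d _ /eqP ne [[|b u] [y [E ->]]]; first by case: E => /ne.
by case: E => <- ->; exists (u ++ y) => //; exists u, y.
Qed.

Lemma deletion_rcons d a s s' : 0 < d -> a != Star -> deletion d (rcons s a) s' ->
  exists2 s1, s' = rcons s1 a & deletion d s s1.
Proof.
case: d => // d _ /eqP ne [u [y [E ->]]].
case/lastP: y E => [|y b] E.
  have lastS t : last t (nseq d.+1 Star) = Star by elim: (d) t => //= k IH t.
  by move: (congr1 (last a) E); rewrite cats0 last_rcons last_cat lastS => /ne.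
move: E; rewrite -!rcons_cat => /rcons_inj [-> ->].
by exists (u ++ y); [rewrite rcons_cat|exists u, y].
Qed.

Lemma nseq_prefix d n a s y : a != Star ->
  nseq n Star ++ a :: s = nseq d Star ++ y ->
  d <= n /\ y = nseq (n - d) Star ++ a :: s.
Proof.
move=> /eqP ne; elim: d n => [|d IH] [|n] //=; try by move=> <-.
  by move=> [/ne].
by move=> [/IH].
Qed.

Lemma deletion_run d n a s s' : a != Star ->
  deletion d (nseq n Star ++ a :: s) s' ->
  (d <= n /\ s' = nseq (n - d) Star ++ a :: s) \/
  (exists2 s1, s' = nseq n Star ++ s1 & deletion d (a :: s) s1).
Proof.
move=> ne; elim: n s' => [|n IH] s' del; first by right; exists s'.
case: del => -[|b u] [y [E ->]].
  by left; apply: nseq_prefix ne E.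
case: E => <- E /=; have [|[le ->]|[s1 -> del]] := IH (u ++ y); first by exists u, y.
  by left; split; [lia|rewrite subSn].
by right; exists s1.
Qed.

Definition atom_le (c c' : nat * nat) := (c.1 <= c'.1) && (c.2 <= c'.2).

Lemma atom_le_refl : reflexive atom_le.
Proof. by move=> c; rewrite /atom_le !leqnn. Qed.

Lemma all2_atom_le_refl L : all2 atom_le L L.
Proof. by elim: L => //= c L ->; rewrite atom_le_refl. Qed.

Lemma all2_atom_le_trans L1 L2 L3 : all2 atom_le L1 L2 -> all2 atom_le L2 L3 ->
  all2 atom_le L1 L3.
Proof.
elim: L1 L2 L3 => [|a L1 IH] [|b L2] [|c L3] //= /andP[ab l12] /andP[bc l23].
by rewrite (IH L2) // andbT; move: ab bc; rewrite /atom_le; lia.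
Qed.

(** A run of stars lies within a single variable, so at most one atom changes and each pair loses at
    most one occurrence. *)
Lemma deletion_chain d L s' : deletion d (chain L) s' ->
  exists L', [/\ s' = chain L', all2 atom_le L' L
    & forall c, count_mem c L <= (count_mem c L').+1].
Proof.
case: d => [|d].
  by move=> [u [y [E ->]]]; exists L; split; [|exact: all2_atom_le_refl|].
elim: L s' => [|[p q] L IH] s' /=.
  by move=> /deletion_cons -[] // s1 _ [[|? ?] [? []]].
have -> : imp_str (atom (p, q)) (chain L) = LBr :: W :: nseq p Star ++
    In :: W :: nseq q Star ++ Arrow :: rcons (chain L) RBr.
  by rewrite /imp_str /atom /mem_str /var /= -!catA cats1.
move=> /deletion_cons -[] // s1 -> /deletion_cons -[] // s2 -> /deletion_run -[] //.
  move=> [le ->]; exists ((p - d.+1, q) :: L); split.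
  - by rewrite /= /imp_str /atom /mem_str /var /= -!catA cats1.
  - by rewrite /= all2_atom_le_refl andbT /atom_le leqnn leq_subr.
  - by move=> c; rewrite /= -addSn leq_add2r; case: eqP.
move=> [s3 -> /deletion_cons -[] // s4 -> /deletion_cons -[] // s5 -> /deletion_run -[] //].
  move=> [le ->]; exists ((p, q - d.+1) :: L); split.
  - by rewrite /= /imp_str /atom /mem_str /var /= -!catA cats1.
  - by rewrite /= all2_atom_le_refl andbT /atom_le leqnn leq_subr.
  - by move=> c; rewrite /= -addSn leq_add2r; case: eqP.
move=> [s6 -> /deletion_cons -[] // s7 -> /deletion_rcons -[] // s8 -> /IH].
move=> [L' [-> le cnt]]; exists ((p, q) :: L'); split.
- by rewrite /= /imp_str /atom /mem_str /var /= -!catA cats1.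
- by rewrite /= le atom_le_refl.
- by move=> c; rewrite /= -addnS leq_add2l.
Qed.

(** * Positions of brackets in a chain *)

Lemma size_chain_cons c L : size (chain (c :: L)) = c.1 + c.2 + size (chain L) + 6.
Proof. by rewrite /= !size_cat /= size_cat !size_nseq /=; lia. Qed.

(** The part before [Bot], which separates the left brackets from the right ones. *)
Definition prefix_chain (L : seq (nat * nat)) : str :=
  flatten [seq LBr :: atom c ++ [:: Arrow] | c <- L].

Lemma chainE L : chain L = prefix_chain L ++ Bot :: nseq (size L) RBr.
Proof.
elim: L => // c L IH.
have -> : nseq (size (c :: L)) RBr = nseq (size L) RBr ++ [:: RBr].
  by rewrite -(nseqD _ 1) addn1.
by rewrite /= IH /imp_str /prefix_chain /= -!catA.
Qed.

(** Each [LBr] is followed by its whole atom before [Bot] is reached. The default [Bot] of [nth] is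
    no bracket, so positions past the end are excluded. *)
Lemma LBr_position L M i : (forall c, c \in L -> M <= c.1 + c.2) ->
  nth Bot (chain L) i = LBr -> i + M < size (prefix_chain L).
Proof.
rewrite chainE nth_cat => hM; case: ltnP => [lti|_]; last first.
  by case: (i - _) => [|j] //=; rewrite nth_nseq; case: ifP.
elim: L hM i lti => [|c L IH] // hM i.
have Ep : prefix_chain (c :: L) = (LBr :: rcons (atom c) Arrow) ++ prefix_chain L.
  by rewrite /prefix_chain /= cats1.
have sz : size (LBr :: rcons (atom c) Arrow) = (c.1 + c.2).+3.+2.
  by rewrite -rcons_cons size_rcons -(size_atom c).
rewrite Ep size_cat nth_cat sz => lti; case: ltnP => lt1 E.
  case: i lt1 E {lti} => [|i] lt1 E.
    by have := hM c (mem_head _ _); move: (c.1 + c.2) => n; lia.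
  have : nth Bot (rcons (atom c) Arrow) i \in rcons (atom c) Arrow.
    by rewrite mem_nth // size_rcons size_atom.
  by rewrite -[nth _ _ _]/(nth Bot (LBr :: rcons (atom c) Arrow) i.+1) E
             mem_rcons inE => /orP[//|/mem_atom].
move: (c.1 + c.2) lt1 lti E => n lt1 lti E; suff : i - n.+3.+2 + M < size (prefix_chain L) by lia.
apply: IH E; last by lia.
by move=> c' c'L; apply: hM; rewrite inE c'L orbT.
Qed.

Lemma RBr_position L i : nth Bot (chain L) i = RBr -> size (prefix_chain L) < i.
Proof.
rewrite chainE nth_cat; case: ltnP => [lti|]; last by rewrite leq_eqVlt => /orP[/eqP<-|//]; rewrite subnn.
move=> E; have : RBr \in prefix_chain L by rewrite -E mem_nth.
move=> /flatten_mapP[c _]; rewrite inE mem_cat => /or3P[//|/mem_atom//|//].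
Qed.

Lemma window_misses_bracket L M u m y : (forall c, c \in L -> M <= c.1 + c.2) ->
  chain L = u ++ m ++ y -> size m <= M -> (LBr \notin m) || (RBr \notin m).
Proof.
move=> hM E sz; apply/negPn/negP; rewrite negb_or !negbK => /andP[lm rm].
have pos a : a \in m -> nth Bot (chain L) (size u + index a m) = a.
  move=> am; rewrite E nth_cat ltnNge leq_addr /= addKn nth_cat index_mem am.
  exact: nth_index.
have := LBr_position hM (pos _ lm); have := RBr_position (pos _ rm).
have := rm; rewrite -index_mem.
move: (index _ m) (index _ m) (size _) (size m) (size u) sz => i j k l n; lia.
Qed.

(** * The zigzag of constraints and its rigidity *)

(* The position of [e] in the zigzag. *)
Definition level h e := if e < h then e.*2 else 4 * h - 1 - e.*2.

Definition links h : seq (nat * nat) :=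
  [seq c <- [seq (p, q) | p <- iota 0 h.*2, q <- iota 0 h.*2]
         | level h c.2 == (level h c.1).+1].

Lemma mem_links h p q : ((p, q) \in links h) =
  [&& p < h.*2, q < h.*2 & level h q == (level h p).+1].
Proof.
rewrite mem_filter andbC andbA; congr andb.
apply/allpairsP/andP => [[[p' q'] [/= + + [-> ->]]]|[lp lq]].
  by rewrite !mem_iota.
by exists (p, q); rewrite !mem_iota.
Qed.

Lemma links_sum h c : c \in links h -> h.*2.-1 <= c.1 + c.2.
Proof.
case: c => p q; rewrite mem_links /level => /and3P[lp lq /eqP] /=.
by case: (ltnP p); case: (ltnP q); lia.
Qed.

(* Along [links h] the index sum is [2h - 1] or [2h], which leaves no room for
   decreasing an index while keeping the levels consecutive. *)
Lemma links_rigid h c c' : c \in links h -> atom_le c' c ->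
  level h c'.2 = (level h c'.1).+1 -> c' = c.
Proof.
case: c c' => [p q] [p' q']; rewrite mem_links /level /= => /and3P[lp lq /eqP lev] /andP[/= lep leq] lev'.
have [-> ->] : p' = p /\ q' = q; last by [].
move: lev lev'; case: (ltnP p); case: (ltnP q); case: (ltnP p'); case: (ltnP q'); lia.
Qed.

Lemma links_up h i : i < h -> (i, h.*2.-1 - i) \in links h.
Proof.
by move=> lt; rewrite mem_links /level lt ifN; [apply/and3P; split|]; try apply/eqP; lia.
Qed.

Lemma links_down h i : i.+1 < h -> (h.*2.-1 - i, i.+1) \in links h.
Proof.
by move=> lt; rewrite mem_links /level lt ifN; [apply/and3P; split|]; try apply/eqP; lia.
Qed.

(** The zigzag starts at 0 and visits every index below [h.*2]; the induction advances two links at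
    a time. *)
Lemma links_level h (tau : nat -> int) :
  (forall c, c \in links h -> (tau c.2 = tau c.1 + 1)%R) ->
  forall e, e < h.*2 -> (tau e = tau 0 + (level h e)%:Z)%R.
Proof.
move=> tauP.
have low_high i : i < h ->
    (tau i = tau 0 + i.*2%:Z /\ tau (h.*2.-1 - i)%N = tau 0 + i.*2.+1%:Z)%R.
  elim: i => [|i IH] lt; move/tauP: (links_up lt) => /= up.
    by split; [rewrite GRing.addr0|rewrite up].
  have [_ E] := IH (ltnW lt); move/tauP: (links_down lt) => /= down.
  by split; rewrite ?up down E; lia.
move=> e lt; rewrite /level; case: ltnP => le; first by have [] := low_high e le.
have [|_] := low_high (h.*2.-1 - e); first lia.
have -> : h.*2.-1 - (h.*2.-1 - e) = e by lia.
move=> ->; congr (_ + Posz _)%R; lia.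
Qed.

(** * Only stars are deleted; conclusion *)

Lemma all_Star (s : str) : (forall a, a != Star -> count_mem a s = 0) ->
  s = nseq (size s) Star.
Proof.
move=> H; apply/all_pred1P/allP => a am; apply/eqP/eqP; apply: contraTT am => ne.
by rewrite -has_pred1 has_count (H a ne).
Qed.

(* The missing bracket gives equal numbers of [LBr] and [RBr] deleted, namely
   none, and the identities of [formula_counts] propagate this to all symbols
   other than [Star]. *)
Lemma deleted_Star s u v x y z : formula s -> formula (u ++ x ++ z) ->
  s = u ++ (v ++ x ++ y) ++ z ->
  (LBr \notin v ++ x ++ y) || (RBr \notin v ++ x ++ y) ->
  v = nseq (size v) Star /\ y = nseq (size y) Star.
Proof.
move=> /formula_counts[e1 e2 e3 e4] /formula_counts[f1 f2 f3 f4] E win.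
have cnt a : count_mem a s = count_mem a (u ++ x ++ z) + count_mem a v + count_mem a y.
  by rewrite E !count_cat; lia.
rewrite !cnt in e1 e2 e3 e4.
have win' : count_mem LBr v + count_mem LBr y = 0 \/
            count_mem RBr v + count_mem RBr y = 0.
  by case/orP: win => /count_memPn; rewrite !count_cat => H; [left|right]; lia.
have zero a : a != Star -> count_mem a v + count_mem a y = 0.
  move: e1 e2 e3 e4 f1 f2 f3 f4 win'.
  do 8! [move: (count_mem _ (u ++ x ++ z)) => ?].
  case: a => // *; lia.
by split; apply: all_Star => a /zero; lia.
Qed.

Theorem mainTheorem1 : ~ context_free stratified_formulae.
Proof.
move=> /context_free_shrink [N shrink].
(* Index sums are at least [h.*2.-1], so this [h] makes atoms longer than the window. Three copies
   leave one intact after two deletions. *)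
pose h := N.+1; pose C := links h; pose L := C ++ C ++ C.
have memL c : c \in L -> c \in C by rewrite !mem_cat !orbb.
have sumL c : c \in L -> N <= c.1 + c.2.
  by move=> /memL/links_sum; rewrite /h; lia.
have FL : stratified_formulae (chain L).
  split; first exact: formula_chain.
  apply: (@stratified_chain _ (level h)) => -[p q] /memL.
  by rewrite mem_links => /and3P[_ _ /eqP].
have szL : N < size (chain L).
  have : (0, h.*2.-1) \in L by rewrite mem_cat -[h.*2.-1]subn0 links_up.
  case: (L) sumL => // c L' sumL _.
  have := sumL c (mem_head _ _); rewrite size_chain_cons.
  by move: (c.1 + c.2) (size _) => i j; lia.
have [u [v [x [y [z [E sz ne [f st]]]]]]] := shrink _ FL szL.
have [Ev Ey] := deleted_Star (formula_chain L) f E (window_misses_bracket sumL E sz).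
(* The runs [v] and [y] are deleted one after the other. *)
have [L1 [E1 le1 cnt1]] : exists L', [/\ u ++ x ++ y ++ z = chain L',
    all2 atom_le L' L & forall c, count_mem c L <= (count_mem c L').+1].
  apply: (@deletion_chain (size v)); exists u, (x ++ y ++ z).
  by rewrite -Ev E -!catA.
have [L2 [E2 le2 cnt2]] : exists L', [/\ u ++ x ++ z = chain L',
    all2 atom_le L' L1 & forall c, count_mem c L1 <= (count_mem c L').+1].
  apply: (@deletion_chain (size y)); exists (u ++ x), z.
  by rewrite -Ey -E1 -!catA.
rewrite E2 in st; have [tau tauP] := chain_stratified st.
have CL2 c : c \in C -> c \in L2.
  move=> cC; have := cnt1 c; have := cnt2 c.
  move: cC; rewrite /L -!has_pred1 !has_count !count_cat.
  move: (count _ _) (count _ _) (count _ _) => i j k; lia.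
have tauE := links_level (fun c cC => tauP c (CL2 c cC)).
have le := all2_atom_le_trans le2 le1.
(* By [tauE] the new pairs still join consecutive levels; being below the old ones, their indices
   stay under [h.*2], and [links_rigid] applies entrywise. *)
have rigid : forall M M', all2 atom_le M' M -> {subset M <= C} ->
    {subset M' <= L2} -> M' = M.
  elim=> [|c M IH] [|c' M'] //= /andP[lec leM] MC ML.
  rewrite (IH M') //; last first.
  - by move=> d dM; apply: ML; rewrite inE dM orbT.
  - by move=> d dM; apply: MC; rewrite inE dM orbT.
  have cC := MC c (mem_head _ _).
  congr (_ :: _); apply: (links_rigid cC lec).
  have := tauP c' (ML c' (mem_head _ _)).
  have : c'.1 < h.*2 /\ c'.2 < h.*2.
    by case: (c) cC lec => p q; rewrite mem_links /atom_le /=; lia.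
  by move=> [/tauE-> /tauE->]; move: (level _ _) (level _ _) => i j; lia.
(* The shortened chain equals the original, so comparing lengths leaves [v ++ y] empty. *)
have EL : L2 = L by apply: rigid le memL _.
apply: ne; apply/nilP; rewrite /nilp.
by move: (congr1 size E); rewrite -EL -E2 !size_cat; lia.
Qed.
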